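(* Let $K$ be an algebraically closed field of arbitrary characteristic and let $f\in\mathfrak m\subset K[[x,y]]$ be reduced, with $r$ irreducible components (branches) $f_1,\dots,f_r$ and conductor ${\bf c}=(c_1,\dots,c_r)\in\mathbb Z_{\ge0}^r$. Define ${\bf d}\in\mathbb Z_{\ge 0}^r$ by $${\bf d}=\begin{cases}{\bf 1} & \text{if } \mathrm{mt}(f)=1,\\ {\bf c}+{\bf 1} & \text{if } \mathrm{mt}(f)=2 \text{ and } r=1,\\ {\bf c} & \text{if } \mathrm{mt}(f)=2 \text{ and } r=2,\\ {\bf c}-{\bf 1} & \text{if } \mathrm{mt}(f)>2,\end{cases}$$ where ${\bf 1}=(1,\dots,1)$. Then $f$ is parametrization ${\bf d}$-determined. In particular, $f$ is always parametrization $({\bf c}+{\bf 1})$-determined.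
   Context: $\mathfrak m=(x,y)$ is the maximal ideal of $K[[x,y]]$. For reduced $f$, let $R=K[[x,y]]/\langle f\rangle$; its integral closure in its total ring of fractions is $\bar R\cong\bigoplus_{i=1}^r K[[t]]$ (one copy per branch). A parametrization of $f$ is the composition $\psi\colon K[[x,y]]\twoheadrightarrow R\hookrightarrow\bar R$ of the projection with a normalization map; it is an element of $J=\mathrm{Hom}_K(K[[x,y]],\bar R)$ (local $K$-algebra morphisms), identified with the tuple of pairs $(x_i(t),y_i(t))=(\psi_i(x),\psi_i(y))$, $i=1,\dots,r$. Two $\psi,\psi'\in J$ are left-right equivalent if there exist an automorphism $\phi$ of $\bar R$ (an $r$-tuple of $K$-algebra automorphisms of $K[[t]]$) and $\Phi\in\mathrm{Aut}_K(K[[x,y]])$ with $\Phi\circ\psi=\phi\circ\psi'$. The conductor ideal $\mathcal C=\{u\in R: u\bar R\subset R\}$ equals $(t^{c_1})\times\cdots\times(t^{c_r})$ in $\bar R$; ${\bf c}=(c_1,\dots,c_r)$ is the conductor of $f$. For ${\bf k}=(k_1,\dots,k_r)\in\mathbb Z_{\ge0}^r$, the ${\bf k}$-jet $j^{\bf k}\psi$ is the composition of $\psi$ with $\bar R\to\bigoplus_i K[[t]]/(t^{k_i+1})$. A parametrization $\psi$ (and $f$) is parametrization ${\bf k}$-determined if every $\psi'\in J$ with $j^{\bf k}\psi'=j^{\bf k}\psi$ is left-right equivalent to $\psi$. $\mathrm{mt}(f)$ is the largest $k$ with $f\in\mathfrak m^k$. *)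

(* Defs.v *)
From HB Require Import structures.
From mathcomp Require Import all_boot all_order all_algebra.
Set Implicit Arguments. Unset Strict Implicit. Unset Printing Implicit Defensive.
Import GRing.Theory.
Local Open Scope ring_scope.

Section PowerSeries.
Variable K : fieldType.

Definition ps := nat -> K.
(* K[[x,y]] : f i j is the coefficient of x^i y^j *)
Definition ps2 := nat -> nat -> K.

Definition ps1 : ps := fun n => (n == 0%N)%:R.
Definition psmul (a b : ps) : ps :=
  fun n => \sum_(i < n.+1) a i * b (n - i)%N.
Definition psexp (a : ps) (k : nat) : ps := iter k (psmul a) ps1.

Definition ps2one : ps2 := fun n m => ((n == 0%N) && (m == 0%N))%:R.
Definition ps2mul (a b : ps2) : ps2 :=
  fun n m => \sum_(i < n.+1) \sum_(j < m.+1) a i j * b (n - i)%N (m - j)%N.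
Definition ps2exp (a : ps2) (k : nat) : ps2 := iter k (ps2mul a) ps2one.

(* g(x(t), y(t)) for x, y in t K[[t]] (the finite sums are exact in that case,
   since x^i y^j has order >= i + j). *)
Definition subst (g : ps2) (x y : ps) : ps :=
  fun n => \sum_(i < n.+1) \sum_(j < n.+1) g i j * psmul (psexp x i) (psexp y j) n.

(* g(P(x,y), Q(x,y)) for P, Q in m = (x,y) *)
Definition subst2 (g P Q : ps2) : ps2 :=
  fun n m => \sum_(i < (n + m).+1) \sum_(j < (n + m).+1)
               g i j * ps2mul (ps2exp P i) (ps2exp Q j) n m.

(* a(phi(t)) for phi in t K[[t]] *)
Definition comp (a phi : ps) : ps :=
  fun n => \sum_(i < n.+1) a i * psexp phi i n.

Definition ps2dvd (f g : ps2) : Prop := exists h : ps2, g = ps2mul f h.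

Definition ps2_reduced (f : ps2) : Prop :=
  forall (g : ps2) (n : nat), ps2dvd f (ps2exp g n) -> ps2dvd f g.

(* mt(f) = k : f in m^k and f notin m^(k+1) *)
Definition mt_is (f : ps2) (k : nat) : Prop :=
  (forall i j, (i + j < k)%N -> f i j = 0) /\
  (exists i j, (i + j = k)%N /\ f i j != 0).

Definition isAut1 (phi : ps) : Prop :=
  phi 0%N = 0 /\ bijective (fun a : ps => comp a phi).
Definition isAut2 (P Q : ps2) : Prop :=
  P 0%N 0%N = 0 /\ Q 0%N 0%N = 0 /\ bijective (fun g : ps2 => subst2 g P Q).

(* Elements of J = Hom(K[[x,y]], (+)_{i<r} K[[t]]) (local K-algebra maps),
   identified with the tuple (x_i(t), y_i(t)); psi g i = g(x_i(t), y_i(t)). *)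
Definition inJ (r : nat) (x y : 'I_r -> ps) : Prop :=
  forall i, x i 0%N = 0 /\ y i 0%N = 0.
Definition psi_app (r : nat) (x y : 'I_r -> ps) (g : ps2) : 'I_r -> ps :=
  fun i => subst g (x i) (y i).

(* psi is a parametrization of f : psi = (normalization map) o (projection),
   i.e. ker psi = <f> and (+) K[[t]] is the integral closure of
   psi(K[[x,y]]) ~ R in its total ring of fractions. *)
Definition is_parametrization (f : ps2) (r : nat) (x y : 'I_r -> ps) : Prop :=
  [/\ inJ x y,
      (forall g : ps2, (forall i, psi_app x y g i = (fun _ => 0)) <-> ps2dvd f g),
      (forall u : 'I_r -> ps, exists (n : nat) (a : nat -> ps2),
         forall i (k : nat),
           psexp (u i) n k + \sum_(l < n) psmul (psi_app x y (a l) i) (psexp (u i) l) k = 0)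
    &
      (forall u : 'I_r -> ps, exists a b : ps2,
         [/\ (forall g : ps2, ps2dvd f (ps2mul b g) -> ps2dvd f g),
             (forall i, psi_app x y b i <> (fun _ => 0))
           & (forall i, psmul (u i) (psi_app x y b i) = psi_app x y a i)])].

(* The conductor {u : u Rbar subset R} equals (t^c_1) x ... x (t^c_r). *)
Definition is_conductor (r : nat) (x y : 'I_r -> ps) (c : 'I_r -> nat) : Prop :=
  forall u : 'I_r -> ps,
    (forall v : 'I_r -> ps, exists g : ps2,
        forall i, psmul (u i) (v i) = psi_app x y g i)
    <-> (forall i (n : nat), (n < c i)%N -> u i n = 0).

Definition lr_equiv (r : nat) (x y x' y' : 'I_r -> ps) : Prop :=
  exists (P Q : ps2) (phi : 'I_r -> ps),
    [/\ isAut2 P Q, (forall i, isAut1 (phi i))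
      & forall (g : ps2) i,
          psi_app x y (subst2 g P Q) i = comp (psi_app x' y' g i) (phi i)].

Definition param_determined (r : nat) (x y : 'I_r -> ps) (k : 'I_r -> nat) : Prop :=
  forall x' y' : 'I_r -> ps, inJ x' y' ->
    (forall (g : ps2) i (n : nat), (n <= k i)%N ->
        psi_app x' y' g i n = psi_app x y g i n) ->
    lr_equiv x y x' y'.

End PowerSeries.

Definition dbound (m r : nat) (c : 'I_r -> nat) : 'I_r -> nat :=
  fun i => if m == 1%N then 1%N
           else if (m == 2%N) && (r == 1%N) then (c i + 1)%N
           else if (m == 2%N) && (r == 2%N) then c i
           else (c i - 1)%N.

(* Main.v *)
Require Import Defs.
From HB Require Import structures.
From mathcomp Require Import all_boot all_order all_algebra.
From mathcomp Require Import boolp zify ring.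
Set Implicit Arguments. Unset Strict Implicit. Unset Printing Implicit Defensive.
Import GRing.Theory.
Local Open Scope ring_scope.

(* Write R = K[[x,y]]/(f), Rbar = prod_i K[[t]], psi for the parametrization, m for the
   maximal ideal (x, y), C = prod_i (t^c_i) for the conductor, n_i = min (ord x_i, ord y_i)
   and n = sum_i n_i.
   If every u in Rbar with ord u_i > d_i is psi(g) for some g in m^2, then f is
   d-determined: writing x' - x = psi(g), y' - y = psi(h), the map (x + g, y + h) is an
   automorphism of K[[x,y]] carrying psi to psi'.  Such g exist for the following reasons.
   - Pigeonhole modulo powers of a generic linear form shows mt(f) <= n.
   - If n > 2, every g with psi(g) in C lies in m^2, because a g of order 1 would make
     Rbar/R a cyclic R-module and thus force n <= 2.
   - If ord u_i >= c_i + n_i, then u = psi(ell h) with ell a generic linear form, psi(h)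
     in C, and h in m as soon as C <> Rbar.
   - If mt(f) = 1, then R = Rbar and n = 1, so u = psi(ell^2 h) whenever ord u >= 2. *)

(** * Formal power series in one variable over a commutative ring *)

Definition series (R : Type) := nat -> R.
(** The alias carries the Cauchy product as its ring structure while staying convertible to [ps];
    iterated, [series (series K)] is convertible to [ps2 K]. *)
HB.instance Definition _ (R : Type) := gen_eqMixin (series R).
HB.instance Definition _ (R : Type) := gen_choiceMixin (series R).

Section SeriesRing.
Variable R : comNzRingType.
Implicit Types a b : series R.

Definition sadd a b : series R := fun n => a n + b n.
Definition sopp a : series R := fun n => - a n.
Definition szero : series R := fun _ => 0.
Definition sone : series R := fun n => (n == 0%N)%:R.
Definition smul a b : series R := fun n => \sum_(i < n.+1) a i * b (n - i)%N.

(** The ring axioms are inherited from polynomials: coefficient n of a product depends only on the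
    truncations of the factors at any N > n. *)
Let trunc N a : {poly R} := \poly_(i < N) a i.

Let smul_trunc N a b n : (n < N)%N -> smul a b n = (trunc N a * trunc N b)`_n.
Proof.
move=> nN; rewrite coefM; apply: eq_bigr => i _.
by rewrite !coef_poly (leq_ltn_trans (leq_subr i n) nN) (leq_ltn_trans _ nN) // -ltnS.
Qed.

Let coef_trunc_mul N a b (p : {poly R}) n : (n < N)%N ->
  (trunc N (smul a b) * p)`_n = (trunc N a * trunc N b * p)`_n.
Proof.
move=> nN; rewrite [LHS]coefM [RHS]coefM; apply: eq_bigr => i _; congr (_ * _).
have iN : (i < N)%N by rewrite (leq_ltn_trans _ nN) // -ltnS.
by rewrite coef_poly iN (smul_trunc _ _ iN).
Qed.

Let smulC : commutative smul.
Proof.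
by move=> a b; apply: funext => n; rewrite !(smul_trunc _ _ (ltnSn n)) mulrC.
Qed.

Let smulA : associative smul.
Proof.
move=> a b c; apply: funext => n; rewrite smulC.
by rewrite !(smul_trunc _ _ (ltnSn n)) !coef_trunc_mul // [in LHS]mulrC mulrA.
Qed.

Let smul1 : left_id sone smul.
Proof.
move=> a; apply: funext => n; rewrite /smul big_ord_recl subn0 mul1r big1 ?addr0 //.
by move=> i _; rewrite mul0r.
Qed.

Let smulD : left_distributive smul sadd.
Proof.
move=> a b c; apply: funext => n; rewrite /smul /sadd -big_split.
by apply: eq_bigr => i _; rewrite mulrDl.
Qed.

Let saddA : associative sadd.
Proof. by move=> a b c; apply: funext => n; exact: addrA. Qed.
Let saddC : commutative sadd.
Proof. by move=> a b; apply: funext => n; exact: addrC. Qed.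
Let sadd0 : left_id szero sadd.
Proof. by move=> a; apply: funext => n; exact: add0r. Qed.
Let saddN : left_inverse szero sopp sadd.
Proof. by move=> a; apply: funext => n; exact: addNr. Qed.

HB.instance Definition _ := GRing.isZmodule.Build (series R) saddA saddC sadd0 saddN.

Let sone_neq0 : sone != 0.
Proof. by apply/eqP => /(congr1 (fun a => a 0%N)) /eqP; rewrite oner_eq0. Qed.

HB.instance Definition _ := GRing.Zmodule_isComNzRing.Build (series R)
  smulA smulC smul1 smulD sone_neq0.

Definition sC (c : R) : series R := fun n => if n == 0%N then c else 0.
Definition sX : series R := fun n => (n == 1%N)%:R.

Lemma scoefD a b n : (a + b) n = a n + b n. Proof. by []. Qed.
Lemma scoefN a n : (- a) n = - a n. Proof. by []. Qed.
Lemma scoefB a b n : (a - b) n = a n - b n. Proof. by []. Qed.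
Lemma scoef0 n : (0 : series R) n = 0. Proof. by []. Qed.
Lemma scoef1 n : (1 : series R) n = (n == 0%N)%:R. Proof. by []. Qed.
Lemma scoefM a b n : (a * b) n = \sum_(i < n.+1) a i * b (n - i)%N. Proof. by []. Qed.
Lemma scoef_sum I (r : seq I) (P : pred I) (F : I -> series R) n :
  (\sum_(i <- r | P i) F i) n = \sum_(i <- r | P i) F i n.
Proof. by elim/big_rec2: _ => // i y z _ <-. Qed.

Lemma scoefCM c a n : (sC c * a) n = c * a n.
Proof.
rewrite scoefM big_ord_recl subn0 big1 ?addr0 // => i _.
by rewrite /sC /= mul0r.
Qed.

Lemma scoefXM a n : (sX * a) n = if n is n'.+1 then a n' else 0.
Proof.
rewrite scoefM; case: n => [|n].
  by rewrite big_ord_recl big_ord0 /sX mul0r addr0.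
rewrite 2!big_ord_recl {1 2}/sX /= mul0r mul1r add0r subSS subn0 big1 ?addr0 //.
by move=> i _; rewrite /sX /= mul0r.
Qed.

Lemma scoefXnM k a n : (sX ^+ k * a) n = if (n < k)%N then 0 else a (n - k)%N.
Proof.
elim: k n => [|k IHk] n; first by rewrite expr0 mul1r subn0.
by rewrite exprS -mulrA scoefXM; case: n => [|n] //; rewrite IHk ltnS subSS.
Qed.

Lemma sC_is_additive : zmod_morphism sC.
Proof.
by move=> c d; apply: funext => n; rewrite scoefB /sC; case: eqP; rewrite ?subr0.
Qed.
Lemma sC_is_multiplicative : monoid_morphism sC.
Proof.
split; first by apply: funext => n; rewrite scoef1 /sC; case: eqP.
by move=> c d; apply: funext => n; rewrite scoefCM /sC; case: eqP; rewrite ?mulr0.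
Qed.
HB.instance Definition _ := GRing.isZmodMorphism.Build R (series R) sC sC_is_additive.
HB.instance Definition _ := GRing.isMonoidMorphism.Build R (series R) sC sC_is_multiplicative.

Lemma scoef0M a b : (a * b) 0%N = a 0%N * b 0%N.
Proof. by rewrite scoefM big_ord_recl big_ord0 addr0. Qed.

(** Order at least k, in a form that covers the zero series without an infinite order. *)
Definition vanish k a := forall n, (n < k)%N -> a n = 0.

Lemma vanish0 a : vanish 0 a. Proof. by []. Qed.
Lemma vanishW k l a : (k <= l)%N -> vanish l a -> vanish k a.
Proof. by move=> kl va n nk; apply: va; apply: leq_trans kl. Qed.
Lemma vanishD k a b : vanish k a -> vanish k b -> vanish k (a + b).
Proof. by move=> va vb n nk; rewrite scoefD va ?vb ?addr0. Qed.
Lemma vanishM k l a b : vanish k a -> vanish l b -> vanish (k + l) (a * b).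
Proof.
move=> va vb n nkl; rewrite scoefM big1 // => i _.
have [ik|ki] := ltnP i k; first by rewrite va ?mul0r.
by rewrite vb ?mulr0 //; have := ltn_ord i; lia.
Qed.
Lemma vanishMl k a b : vanish k b -> vanish k (a * b).
Proof. by move=> vb; have := vanishM (@vanish0 a) vb. Qed.
Lemma vanishMr k a b : vanish k a -> vanish k (a * b).
Proof. by rewrite mulrC; exact: vanishMl. Qed.
Lemma vanishX k a i : vanish k a -> vanish (k * i) (a ^+ i).
Proof.
move=> va; elim: i => [|i IHi]; first by rewrite muln0.
by rewrite exprS mulnS; apply: vanishM.
Qed.
Lemma vanish1 a : a 0%N = 0 -> vanish 1 a.
Proof. by move=> a0 [|n]. Qed.

Lemma scoefM_low k l a b : vanish k a -> vanish l b -> (a * b) (k + l)%N = a k * b l.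
Proof.
move=> va vb; rewrite scoefM.
have kP : (k < (k + l).+1)%N by rewrite ltnS leq_addr.
rewrite (bigD1 (Ordinal kP)) //= addKn big1 ?addr0 // => i.
rewrite -val_eqE /= neq_ltn => /orP[ik|ki]; first by rewrite va ?mul0r.
by rewrite vb ?mulr0 //; have := ltn_ord i; lia.
Qed.

Lemma scoefX_low k a i : vanish k a -> (a ^+ i) (k * i)%N = a k ^+ i.
Proof.
move=> va; elim: i => [|i IHi]; first by rewrite muln0 !expr0.
by rewrite !exprS mulnS scoefM_low ?IHi //; apply: vanishX.
Qed.

Lemma vanishP k a : vanish k a <-> exists b, a = sX ^+ k * b.
Proof.
split=> [va|[b ->] n nk]; last by rewrite scoefXnM nk.
exists (fun n => a (n + k)%N); apply: funext => n; rewrite scoefXnM.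
by case: ltnP => [/va//|kn]; rewrite subnK.
Qed.

Lemma sXnI k a b : sX ^+ k * a = sX ^+ k * b -> a = b.
Proof.
move=> e; apply: funext => n; move/(congr1 (fun c => c (n + k)%N)): e.
by rewrite !scoefXnM ltnNge leq_addl /= addnK.
Qed.

(* The inverse of [1 - u], where [u 0 = 0], is the sum of the [u ^+ k]. *)
Lemma series_inv a d : a 0%N * d = 1 -> exists b, a * b = 1.
Proof.
move=> ad; pose u := 1 - sC d * a.
have vu : vanish 1 u.
  by apply: vanish1; rewrite /u scoefB scoefCM scoef1 eqxx mulrC ad subrr.
pose g : series R := fun n => (\sum_(k < n.+1) u ^+ k) n.
exists (sC d * g); rewrite mulrCA mulrA; have -> : sC d * a = 1 - u by rewrite /u; ring.
apply: funext => n.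
have -> : ((1 - u) * g) n = ((1 - u) * \sum_(k < n.+1) u ^+ k) n.
  rewrite !scoefM; apply: eq_bigr => i _; congr (_ * _).
  rewrite /g !scoef_sum -(big_mkord xpredT (fun k => (u ^+ k) (n - i)%N)).
  rewrite -[RHS](big_mkord xpredT (fun k => (u ^+ k) (n - i)%N)).
  rewrite [RHS](@big_cat_nat _ _ _ (n - i).+1) ?ltnS ?leq_subr //=.
  rewrite [X in _ = _ + X]big_nat_cond [X in _ = _ + X]big1 ?addr0 // => k.
  rewrite andbT => /andP[nik _]; apply: (vanishX (i:=k) vu); lia.
rewrite -opprB mulNr -subrX1 opprB scoefB (_ : (u ^+ n.+1) n = 0) ?subr0 //.
by apply: (vanishX (i:=n.+1) vu); rewrite mul1n.
Qed.
End SeriesRing.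

(** * Orders and division in K[[t]] *)

Section Division.
Variable K : fieldType.
Implicit Types u v w : series K.

(** Here u is t^k times a unit, so after removing t^k from v the unit can be inverted. *)
Lemma series_div k e u v : vanish k u -> u k != 0 -> vanish (k + e) v ->
  exists2 w, vanish e w & v = u * w.
Proof.
move=> /vanishP[u' ->]; rewrite scoefXnM ltnn subnn => u'0 /vanishP[v' ->].
have [b ub] : exists b, u' * b = 1 by apply: series_inv (mulfV u'0).
exists (sX K ^+ e * (v' * b)); first by apply/vanishP; exists (v' * b).
transitivity (sX K ^+ (k + e) * v' * (u' * b)); first by rewrite ub mulr1.
rewrite exprD; ring.
Qed.

Lemma exists_order u : u <> 0 -> exists2 k, vanish k u & u k != 0.
Proof.
move=> u0; have ex : exists n, u n != 0.
  apply: contrapT => nex; apply: u0; apply: funext => n.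
  by apply: contrapT => /eqP un; apply: nex; exists n.
case: (ex_minnP ex) => k uk kmin; exists k => // n nk.
by apply/eqP; apply: contraLR nk => /kmin; rewrite -leqNgt.
Qed.

Lemma series_mulI u : u <> 0 -> injective ( *%R u).
Proof.
move=> /exists_order[k /vanishP[u' ->]]; rewrite scoefXnM ltnn subnn => u'0 v w.
rewrite -!mulrA => /sXnI e.
have [b ub] : exists b, u' * b = 1 by apply: series_inv (mulfV u'0).
by rewrite -[v]mul1r -[w]mul1r -ub mulrAC e mulrAC.
Qed.

End Division.

(** * Power series in two variables and substitution *)

Section TwoVariables.
Variable K : fieldType.
Local Notation S1 := (series K).
Local Notation S2 := (series (series K)).
Implicit Types g h P Q : S2.

(** The outer index is the exponent of x and the inner one that of y, so y is a constant of the
    outer series ring. *)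
Definition vX : S2 := sX S1.
Definition vY : S2 := sC (sX K).
Definition c2 (c : K) : S2 := sC (sC c).

Lemma coef2D g h i j : (g + h) i j = g i j + h i j. Proof. by []. Qed.
Lemma coef2B g h i j : (g - h) i j = g i j - h i j. Proof. by []. Qed.
Lemma coef2_sum I (r : seq I) (D : pred I) (F : I -> S2) i j :
  (\sum_(k <- r | D k) F k) i j = \sum_(k <- r | D k) F k i j.
Proof. by rewrite !scoef_sum. Qed.
Lemma coef2M g h n m : (g * h) n m =
  \sum_(i < n.+1) \sum_(j < m.+1) g i j * h (n - i)%N (m - j)%N.
Proof. by rewrite scoefM scoef_sum. Qed.

Lemma coef2_monomial c i j n m :
  (c2 c * vX ^+ i * vY ^+ j) n m = if (n == i) && (m == j) then c else 0.
Proof.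
rewrite -mulrA mulrCA scoefXnM /vY -rmorphXn -rmorphM /=.
case: ltnP => [ni|ni]; first by rewrite (ltn_eqF ni).
rewrite /sC subn_eq0 eqn_leq ni andbT; case: (n <= i)%N => //=.
rewrite mulrC scoefXnM subn_eq0 eqn_leq; case: ltnP => [mj|jm]; first by rewrite andbF.
by rewrite andbT.
Qed.

Definition vanish2 k g := forall i j, (i + j < k)%N -> g i j = 0.

Lemma vanish2W k l g : (k <= l)%N -> vanish2 l g -> vanish2 k g.
Proof. by move=> kl vg i j ijk; apply: vg; apply: leq_trans kl. Qed.
Lemma vanish2D k g h : vanish2 k g -> vanish2 k h -> vanish2 k (g + h).
Proof. by move=> vg vh i j ijk; rewrite coef2D vg ?vh ?addr0. Qed.
Lemma vanish2B k g h : vanish2 k g -> vanish2 k h -> vanish2 k (g - h).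
Proof. by move=> vg vh i j ijk; rewrite coef2B vg ?vh ?subr0. Qed.
Lemma vanish2M k l g h : vanish2 k g -> vanish2 l h -> vanish2 (k + l) (g * h).
Proof.
move=> vg vh n m nm; rewrite coef2M big1 // => i _; rewrite big1 // => j _.
have [ijk|kij] := ltnP (i + j) k; first by rewrite vg ?mul0r.
by rewrite vh ?mulr0 //; have := ltn_ord i; have := ltn_ord j; lia.
Qed.
Lemma vanish2X k g i : vanish2 k g -> vanish2 (k * i) (g ^+ i).
Proof.
move=> vg; elim: i => [|i IHi]; first by rewrite muln0.
by rewrite exprS mulnS; apply: vanish2M.
Qed.
Lemma vanish2Ml k g h : vanish2 k h -> vanish2 k (g * h).
Proof. by move=> vh; have := @vanish2M 0 k g h (fun _ _ => ltac:(by [])) vh. Qed.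
Lemma vanish21 g : g 0%N 0%N = 0 -> vanish2 1 g.
Proof. by move=> g0 [|i] [|j]. Qed.

(** All terms divisible by x go into g1; what remains is a series in y alone. *)
Lemma vanish2_decomp g : g 0%N 0%N = 0 ->
  exists g1 g2, [/\ g = vX * g1 + vY * g2, g1 0%N 0%N = g 1%N 0%N & g2 0%N 0%N = g 0%N 1%N].
Proof.
move=> g00; exists (fun n => g n.+1), (sC ((fun m => g 0%N m.+1) : S1)); split=> //.
apply: funext => n; rewrite scoefD scoefXM /vY -rmorphM /=.
case: n => [|n]; last by rewrite /sC /= addr0.
by rewrite add0r /sC /=; apply: funext => m; rewrite scoefXM; case: m.
Qed.

Lemma series2_trunc M g :
  vanish2 M (g - \sum_(i < M) \sum_(j < M) c2 (g i j) * vX ^+ i * vY ^+ j).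
Proof.
move=> n m nmM; rewrite coef2B coef2_sum.
have nM : (n < M)%N by lia.
have mM : (m < M)%N by lia.
rewrite (bigD1 (Ordinal nM)) //= coef2_sum (bigD1 (Ordinal mM)) //= coef2_monomial !eqxx /=.
rewrite big1 => [|j jm]; last first.
  by rewrite coef2_monomial eqxx /= eq_sym; move: jm; rewrite -val_eqE /= => /negPf->.
rewrite big1 => [|i im]; first by rewrite !addr0 subrr.
rewrite coef2_sum big1 // => j _; rewrite coef2_monomial eq_sym.
by move: im; rewrite -val_eqE /= => /negPf->.
Qed.

(* Density of polynomials for the m-adic topology. *)
Lemma series2_ext M (A : zmodType) (F G : S2 -> A) :
  {morph F : g h / g + h} -> {morph G : g h / g + h} ->
  (forall g, vanish2 M g -> F g = 0) -> (forall g, vanish2 M g -> G g = 0) ->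
  (forall c i j, F (c2 c * vX ^+ i * vY ^+ j) = G (c2 c * vX ^+ i * vY ^+ j)) ->
  F =1 G.
Proof.
move=> FD GD Fv Gv FG g.
rewrite -(subrK (\sum_(i < M) \sum_(j < M) c2 (g i j) * vX ^+ i * vY ^+ j) g).
rewrite FD GD (Fv _ (@series2_trunc M g)) (Gv _ (@series2_trunc M g)).
have F0 : F 0 = 0 by apply: Fv.
have G0 : G 0 = 0 by apply: Gv.
rewrite (big_morph F FD F0) (big_morph G GD G0); congr (_ + _).
apply: eq_bigr => i _; rewrite (big_morph F FD F0) (big_morph G GD G0).
by apply: eq_bigr => j _; exact: FG.
Qed.

Lemma psmulE (a b : S1) : psmul a b = a * b. Proof. by []. Qed.

Lemma psexpE (a : S1) k : psexp a k = a ^+ k.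
Proof. by elim: k => // k IHk; rewrite exprS -IHk. Qed.

Lemma ps2mulE g h : ps2mul g h = g * h.
Proof. by apply: funext => n; apply: funext => m; rewrite coef2M. Qed.

Lemma ps2expE g k : ps2exp g k = g ^+ k.
Proof.
elim: k => [|k IHk]; last by rewrite exprS -IHk -ps2mulE.
apply: funext => n; apply: funext => m; rewrite expr0 /ps2exp /= /ps2one (scoef1 S1).
by case: n => [|n] /=; rewrite ?(scoef1 K).
Qed.

Section Subst.
Variables x y : S1.

Lemma substD g h : subst (g + h) x y = (subst g x y : S1) + subst h x y.
Proof.
apply: funext => n; rewrite scoefD /subst -big_split; apply: eq_bigr => i _ /=.
by rewrite -big_split; apply: eq_bigr => j _ /=; rewrite coef2D mulrDl.
Qed.

Lemma subst_vanish d k g : vanish d x -> vanish d y -> vanish2 k g ->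
  vanish (d * k) (subst g x y : S1).
Proof.
move=> vx vy vg n nk; rewrite /subst big1 // => i _; rewrite big1 // => j _.
have [ijk|kij] := ltnP (i + j) k; first by rewrite vg ?mul0r.
rewrite !psexpE psmulE (vanishM (vanishX (i:=i) vx) (vanishX (i:=j) vy)) ?mulr0 //.
rewrite -mulnDr; apply: leq_trans nk _; exact: leq_mul.
Qed.

Hypothesis (x0 : x 0%N = 0) (y0 : y 0%N = 0).

Lemma subst_monomial c i j :
  subst (c2 c * vX ^+ i * vY ^+ j) x y = sC c * x ^+ i * y ^+ j.
Proof.
apply: funext => n; rewrite -[in RHS]mulrA scoefCM /subst.
have [ijn|nij] := ltnP n (i + j).
  rewrite (vanishM (vanishX (i:=i) (vanish1 x0)) (vanishX (i:=j) (vanish1 y0))) ?mul1n //.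
  rewrite mulr0 big1 // => k _; rewrite big1 // => l _; rewrite coef2_monomial.
  case: ifP => [/andP[/eqP-> /eqP->]|_]; last by rewrite mul0r.
  rewrite !psexpE psmulE.
  by rewrite (vanishM (vanishX (i:=i) (vanish1 x0)) (vanishX (i:=j) (vanish1 y0))) ?mul1n ?mulr0.
have iP : (i < n.+1)%N by lia.
have jP : (j < n.+1)%N by lia.
rewrite (bigD1 (Ordinal iP)) //= (bigD1 (Ordinal jP)) //= coef2_monomial !eqxx /=.
rewrite !psexpE psmulE big1 => [|l lj]; last first.
  by rewrite coef2_monomial eqxx /=; move: lj; rewrite -val_eqE /= => /negPf->; rewrite mul0r.
rewrite big1 ?addr0 // => k ki; rewrite big1 // => l _; rewrite coef2_monomial.
by move: ki; rewrite -val_eqE /= => /negPf->; rewrite mul0r.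
Qed.

(** Both sides are additive in g and in h, and their coefficient n sees g and h only modulo m^(n+1).
    Density, applied once in each argument, leaves the case of monomials. *)
Lemma substM g h : subst (g * h) x y = (subst g x y : S1) * subst h x y.
Proof.
have v2 k u : vanish2 k u -> vanish k (subst u x y : S1).
  by move=> /(subst_vanish (vanish1 x0) (vanish1 y0)); rewrite mul1n.
apply: funext => n; move: g.
apply: (@series2_ext n.+1 _ (fun g => subst (g * h) x y n)
  (fun g => ((subst g x y : S1) * subst h x y) n)).
- by move=> g g'; rewrite mulrDl substD.
- by move=> g g'; rewrite substD mulrDl.
- by move=> g vg; apply: (v2 n.+1) => //; rewrite mulrC; apply: vanish2Ml.
- by move=> g vg; apply: (@vanishMr _ n.+1) => //; apply: v2.
move=> c i j; move: h.
apply: (@series2_ext n.+1 _ (fun h => subst (c2 c * vX ^+ i * vY ^+ j * h) x y n)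
  (fun h => ((subst (c2 c * vX ^+ i * vY ^+ j) x y : S1) * subst h x y) n)).
- by move=> g g'; rewrite mulrDr substD.
- by move=> g g'; rewrite substD mulrDr.
- by move=> g vg; apply: (v2 n.+1) => //; apply: vanish2Ml.
- by move=> g vg; apply: (@vanishMl _ n.+1) => //; apply: v2.
move=> d k l; have -> : c2 c * vX ^+ i * vY ^+ j * (c2 d * vX ^+ k * vY ^+ l) =
    c2 (c * d) * vX ^+ (i + k) * vY ^+ (j + l).
  rewrite /c2 !rmorphM !exprD; ring.
rewrite !subst_monomial rmorphM !exprD; congr ((_ : S1) n); rewrite /=; ring.
Qed.

(** The proofs that x and y have no constant term are arguments, so that a ring morphism structure
    can be attached to [ev x0 y0]. *)
Definition ev (_ : x 0%N = 0) (_ : y 0%N = 0) g : S1 := subst g x y.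

Lemma ev_c2 c : ev x0 y0 (c2 c) = sC c.
Proof. by have := subst_monomial c 0 0; rewrite !expr0 !mulr1. Qed.
Lemma ev_vX : ev x0 y0 vX = x.
Proof. by have := subst_monomial 1 1 0; rewrite /c2 !rmorph1 !expr0 !mulr1 !mul1r. Qed.
Lemma ev_vY : ev x0 y0 vY = y.
Proof. by have := subst_monomial 1 0 1; rewrite /c2 !rmorph1 !expr0 !mulr1 !mul1r. Qed.

Lemma ev_is_additive : zmod_morphism (ev x0 y0).
Proof.
by move=> g h; apply: (addIr (ev x0 y0 h)); rewrite -[LHS]substD !subrK.
Qed.
Lemma ev_is_multiplicative : monoid_morphism (ev x0 y0).
Proof. by split; [have := ev_c2 1; rewrite /c2 !rmorph1 | exact: substM]. Qed.
End Subst.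

HB.instance Definition _ x y (x0 : x 0%N = 0) (y0 : y 0%N = 0) :=
  GRing.isZmodMorphism.Build S2 S1 (ev x0 y0) (ev_is_additive x0 y0).
HB.instance Definition _ x y (x0 : x 0%N = 0) (y0 : y 0%N = 0) :=
  GRing.isMonoidMorphism.Build S2 S1 (ev x0 y0) (ev_is_multiplicative x0 y0).

Lemma ev_vanish x y (x0 : x 0%N = 0) (y0 : y 0%N = 0) d k g :
  vanish d x -> vanish d y -> vanish2 k g -> vanish (d * k) (ev x0 y0 g).
Proof. exact: subst_vanish. Qed.

Lemma ev_coef0 x y (x0 : x 0%N = 0) (y0 : y 0%N = 0) g : ev x0 y0 g 0%N = g 0%N 0%N.
Proof.
rewrite /ev /subst !big_ord_recl !big_ord0 !addr0 !psexpE !expr0.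
by rewrite psmulE mulr1 scoef1 mulr1.
Qed.

End TwoVariables.

(** * Automorphisms tangent to the identity *)

Section Automorphisms.
Variable K : fieldType.
Local Notation S1 := (series K).
Local Notation S2 := (series (series K)).
Implicit Types g h P Q : S2.

(* The inverse is the Neumann series of the topologically nilpotent [id - T]. *)
Lemma bijective_unipotent (T : S2 -> S2) : {morph T : g h / g + h} ->
  (forall k g, vanish2 k g -> vanish2 k.+1 (g - T g)) -> bijective T.
Proof.
move=> TD Tv; pose D g := g - T g.
have T0 : T 0 = 0 by apply: (addIr (T 0)); rewrite -TD !add0r.
have DD : {morph D : g h / g + h} by move=> g h; rewrite /D TD; ring.
have Dv l k g : vanish2 k g -> vanish2 (l + k) (iter l D g).
  by move=> vg; elim: l => //= l IHl; apply: Tv.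
have TDl l h : T (iter l D h) = iter l D h - iter l.+1 D h by rewrite /= /D; ring.
have DTl l h : iter l D (T h) = iter l D h - iter l.+1 D h.
  have iterD (a b : S2) : iter l D (a + b) = iter l D a + iter l D b.
    by elim: l => //= l' ->; rewrite DD.
  by apply: (addIr (iter l.+1 D h)); rewrite subrK iterSr -iterD /D addrC subrK.
pose G N h := \sum_(l < N) iter l D h.
(* Each coefficient is read off a long enough partial sum: the l-th term lies in m^l and cannot
   affect degrees below l. *)
pose inv h : S2 := fun n m => G (n + m).+1 h n m.
have invG N h : vanish2 N (inv h - G N h).
  move=> n m nmN; rewrite coef2B /inv /G !coef2_sum.
  rewrite -(big_mkord xpredT (fun l => iter l D h n m)).
  rewrite -(big_mkord xpredT (fun l => iter l D h n m)).
  rewrite [X in _ - X](@big_cat_nat _ _ _ (n + m).+1) //=.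
  rewrite [X in _ - (_ + X)]big_nat_cond [X in _ - (_ + X)]big1 ?addr0 ?subrr // => l.
  by rewrite andbT => /andP[nml _]; apply: (Dv l 0%N) => //; rewrite addn0.
have Tvan k g : vanish2 k g -> vanish2 k (T g).
  move=> vg; have -> : T g = g - (g - T g) by ring.
  by apply: vanish2B => //; apply: vanish2W (Tv _ _ vg).
have GN N (F : nat -> S2) : \sum_(l < N) (F l - F l.+1) = F 0%N - F N.
  by elim: N => [|N IHN]; rewrite ?big_ord0 ?subrr // big_ord_recr IHN /=; ring.
have Dlast h n m : iter (n + m).+1 D h n m = 0.
  by apply: (Dv (n + m).+1 0%N) => //; rewrite addn0.
exists inv => h; apply: funext => n; apply: funext => m.
  rewrite /inv /G (eq_bigr (fun l : 'I_ _ => iter l D h - iter l.+1 D h)) //.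
  rewrite (GN _ (fun l => iter l D h)).
  by rewrite coef2B Dlast subr0.
rewrite -[inv h](subrK (G (n + m).+1 h)) TD coef2D (Tvan _ _ (invG _ h)) // add0r.
rewrite /G (big_morph T TD T0).
rewrite (eq_bigr (fun l : 'I_ _ => iter l D h - iter l.+1 D h)) //.
rewrite (GN _ (fun l => iter l D h)).
by rewrite coef2B Dlast subr0.
Qed.

Lemma vX_vanish : vanish2 1 (vX K).
Proof. by apply: vanish21; rewrite /vX /sX. Qed.
Lemma vY_vanish : vanish2 1 (vY K).
Proof. by apply: vanish21. Qed.

Section Subst2.
Variables P Q : S2.

Lemma subst2D g h : subst2 (g + h) P Q = (subst2 g P Q : S2) + subst2 h P Q.
Proof.
apply: funext => n; apply: funext => m; rewrite coef2D /subst2 -big_split.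
apply: eq_bigr => i _ /=; rewrite -big_split; apply: eq_bigr => j _ /=.
by rewrite coef2D mulrDl.
Qed.

Hypothesis (vP : vanish2 1 P) (vQ : vanish2 1 Q).

Let vPQ i j n m : (n + m < i + j)%N -> (P ^+ i * Q ^+ j) n m = 0.
Proof.
move=> nm; apply: (vanish2M (vanish2X (i:=i) vP) (vanish2X (i:=j) vQ)).
by rewrite !mul1n.
Qed.

Lemma subst2_vanish k g : vanish2 k g -> vanish2 k (subst2 g P Q : S2).
Proof.
move=> vg n m nmk; rewrite /subst2 big1 // => i _; rewrite big1 // => j _.
have [ijk|kij] := ltnP (i + j) k; first by rewrite vg ?mul0r.
by rewrite !ps2expE ps2mulE vPQ ?mulr0 // (leq_trans nmk).
Qed.

Lemma subst2_monomial c i j :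
  subst2 (c2 c * vX K ^+ i * vY K ^+ j) P Q = c2 c * P ^+ i * Q ^+ j.
Proof.
apply: funext => n; apply: funext => m.
rewrite /subst2 -[in RHS]mulrA scoefCM scoefCM.
have [nmij|ijnm] := ltnP (n + m) (i + j).
  rewrite vPQ // mulr0 big1 // => k _; rewrite big1 // => l _; rewrite coef2_monomial.
  case: ifP => [/andP[/eqP-> /eqP->]|_]; last by rewrite mul0r.
  by rewrite !ps2expE ps2mulE vPQ // mulr0.
have iP : (i < (n + m).+1)%N by lia.
have jP : (j < (n + m).+1)%N by lia.
rewrite (bigD1 (Ordinal iP)) //= (bigD1 (Ordinal jP)) //= coef2_monomial !eqxx /=.
rewrite !ps2expE ps2mulE big1 => [|l lj]; last first.
  by rewrite coef2_monomial eqxx /=; move: lj; rewrite -val_eqE /= => /negPf->; rewrite mul0r.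
rewrite big1 ?addr0 // => k ki; rewrite big1 // => l _; rewrite coef2_monomial.
by move: ki; rewrite -val_eqE /= => /negPf->; rewrite mul0r.
Qed.

Lemma subst_subst2 g (x y : S1) : x 0%N = 0 -> y 0%N = 0 ->
  subst (subst2 g P Q) x y = subst g (subst P x y) (subst Q x y).
Proof.
move=> x0 y0; apply: funext => n.
have v1 := vanish1 x0; have v1' := vanish1 y0.
have sP0 : subst P x y 0%N = 0 by apply: (subst_vanish v1 v1' vP).
have sQ0 : subst Q x y 0%N = 0 by apply: (subst_vanish v1 v1' vQ).
move: g; apply: (@series2_ext K n.+1 _ (fun g => subst (subst2 g P Q) x y n)
  (fun g => subst g (subst P x y) (subst Q x y) n)).
- by move=> g h; rewrite subst2D substD.
- by move=> g h; rewrite substD.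
- by move=> g vg; apply: (subst_vanish v1 v1' (subst2_vanish vg)); rewrite mul1n.
- move=> g vg; apply: (subst_vanish (vanish1 sP0) (vanish1 sQ0) vg); by rewrite mul1n.
move=> c i j; have e : ev x0 y0 (c2 c * P ^+ i * Q ^+ j) =
    sC c * ev x0 y0 P ^+ i * ev x0 y0 Q ^+ j by rewrite !rmorphM !rmorphXn /= ev_c2.
apply: (etrans (congr1 (fun h : S2 => subst h x y n) (subst2_monomial c i j))).
apply: (etrans (congr1 (fun s : S1 => s n) e)).
exact: (congr1 (fun s : S1 => s n) (esym (subst_monomial sP0 sQ0 c i j))).
Qed.

End Subst2.

Lemma subst2_id g : subst2 g (vX K) (vY K) = g.
Proof.
apply: funext => n; apply: funext => m.
move: g; apply: (@series2_ext K (n + m).+1 _ (fun g => subst2 g (vX K) (vY K) n m)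
  (fun g => g n m)) => [g h|g h|g vg|g vg|c i j].
- by rewrite subst2D.
- by [].
- exact: (subst2_vanish vX_vanish vY_vanish vg).
- exact: vg.
- by rewrite subst2_monomial //; [exact: vX_vanish | exact: vY_vanish].
Qed.

(** Replacing x, y by P, Q alters a monomial of degree i + j only in degrees above i + j. Hence g -
    g(P, Q) gains one order over g, and the substitution is unipotent. *)
Lemma isAut2_tangent_id P Q : vanish2 2 (P - vX K) -> vanish2 2 (Q - vY K) -> isAut2 P Q.
Proof.
move=> vPX vQY.
have vP : vanish2 1 P.
  by rewrite -[P](subrK (vX K)); apply: vanish2D vX_vanish; apply: vanish2W vPX.
have vQ : vanish2 1 Q.
  by rewrite -[Q](subrK (vY K)); apply: vanish2D vY_vanish; apply: vanish2W vQY.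
have vpow (A B : S2) i : vanish2 1 A -> vanish2 1 B -> vanish2 2 (A - B) ->
    vanish2 i.+1 (A ^+ i - B ^+ i).
  move=> vA vB vAB; elim: i => [|i IHi]; first by rewrite !expr0 subrr.
  have -> : A ^+ i.+1 - B ^+ i.+1 = A * (A ^+ i - B ^+ i) + (A - B) * B ^+ i.
    by rewrite !exprS; ring.
  apply: vanish2D; first exact: (vanish2M vA IHi).
  by have := vanish2M vAB (vanish2X (i:=i) vB); rewrite mul1n.
have vmon i j : vanish2 (i + j).+1 (P ^+ i * Q ^+ j - vX K ^+ i * vY K ^+ j).
  have -> : P ^+ i * Q ^+ j - vX K ^+ i * vY K ^+ j =
    (P ^+ i - vX K ^+ i) * Q ^+ j + vX K ^+ i * (Q ^+ j - vY K ^+ j) by ring.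
  apply: vanish2D.
    by have := vanish2M (vpow P (vX K) i vP vX_vanish vPX) (vanish2X (i:=j) vQ); rewrite mul1n.
  have := vanish2M (vanish2X (i:=i) vX_vanish) (vpow Q (vY K) j vQ vY_vanish vQY).
  by rewrite mul1n addnS.
split; first exact: vP; split; first exact: vQ.
apply: bijective_unipotent (fun g h => subst2D P Q g h) _ => k g vg n m nmk.
rewrite -{1}[g]subst2_id coef2B -opprB; apply/eqP; rewrite oppr_eq0; apply/eqP.
rewrite /subst2 -sumrB big1 // => i _; rewrite -sumrB big1 // => j _; rewrite -mulrBr.
have [ijk|kij] := ltnP (i + j) k; first by rewrite vg ?mul0r.
rewrite !ps2expE !ps2mulE -coef2B vmon ?mulr0 //; lia.
Qed.

Lemma comp_sX (a : S1) : Defs.comp a (sX K) = a.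
Proof.
apply: funext => n; rewrite /Defs.comp (bigD1 ord_max) //= psexpE -[_ ^+ n]mulr1.
rewrite scoefXnM ltnn subnn scoef1 mulr1 big1 ?addr0 // => i.
rewrite -val_eqE /= => ni; rewrite psexpE -[_ ^+ i]mulr1 scoefXnM.
by case: ifP => [|_]; rewrite ?mulr0 // scoef1 subn_eq0 leqNgt ltn_neqAle ni -ltnS ltn_ord mulr0.
Qed.

Lemma isAut1_id : isAut1 (sX K).
Proof. by split=> //; exists id => a; exact: comp_sX. Qed.

End Automorphisms.

(** A homogeneous linear system with more unknowns than equations; arbitrary finite index types
    allow pairs (branch, exponent) below. *)
Lemma kernel_of_card (K : fieldType) (A B : finType) (M : B -> A -> K) :
  (#|B| < #|A|)%N ->
  exists2 l : A -> K, exists a, l a != 0 & forall b, \sum_a l a * M b a = 0.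
Proof.
move=> BA; pose N := \matrix_(i < #|A|, j < #|B|) M (enum_val j) (enum_val i).
have : kermx N != 0.
  rewrite -mxrank_eq0 mxrank_ker subn_eq0 -ltnNge; apply: leq_ltn_trans BA.
  exact: rank_leq_col.
move=> /rowV0Pn[v /sub_kermxP vN v0].
exists (fun a => v 0 (enum_rank a)) => [|b].
  move/rV0Pn: v0 => [i vi]; exists (enum_val i); by rewrite enum_valK.
move/matrixP: vN => /(_ 0 (enum_rank b)); rewrite !mxE => vN; apply: etrans vN.
rewrite [RHS](reindex (@enum_rank A)) /=; last exact: onW_bij (@enum_rank_bij A).
by apply: eq_bigr => a _; rewrite mxE !enum_rankK.
Qed.

(** * Determinacy from lifts to the square of the maximal ideal *)

Section Determinacy.
Variables (K : fieldType) (r : nat) (x y : 'I_r -> series K).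

Lemma param_determined_mono (k l : 'I_r -> nat) :
  (forall i, (k i <= l i)%N) -> param_determined x y k -> param_determined x y l.
Proof.
move=> kl det x' y' J' jets; apply: det => // g i n nk; apply: jets.
exact: leq_trans (kl i).
Qed.

Hypotheses (x0 : forall i, x i 0%N = 0) (y0 : forall i, y i 0%N = 0).

Lemma param_determined_lift (d : 'I_r -> nat) :
  (forall u : 'I_r -> series K, (forall i, vanish (d i).+1 (u i)) ->
     exists2 g, vanish2 2 g & forall i, ev (x0 i) (y0 i) g = u i) ->
  param_determined x y d.
Proof.
move=> lift x' y' J' jets.
(* Equality of jets is assumed on images of series; applied to the coordinates x and y it bounds the
   orders of x' - x and y' - y. *)
have subX i : x' i = subst (vX K) (x' i) (y' i)
    by apply/esym; exact: (ev_vX (J' i).1 (J' i).2).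
have subY i : y' i = subst (vY K) (x' i) (y' i)
    by apply/esym; exact: (ev_vY (J' i).1 (J' i).2).
have [g vg eg] : exists2 g, vanish2 2 g &
    forall i, ev (x0 i) (y0 i) g = (x' i : series K) - x i.
  apply: lift => i n nd; rewrite scoefB subX.
  by have := jets (vX K) i n nd; rewrite /psi_app => ->;
    rewrite -[subst _ _ _]/(ev (x0 i) (y0 i) (vX K)) ev_vX subrr.
have [h vh eh] : exists2 h, vanish2 2 h &
    forall i, ev (x0 i) (y0 i) h = (y' i : series K) - y i.
  apply: lift => i n nd; rewrite scoefB subY.
  by have := jets (vY K) i n nd; rewrite /psi_app => ->;
    rewrite -[subst _ _ _]/(ev (x0 i) (y0 i) (vY K)) ev_vY subrr.
exists (vX K + g), (vY K + h), (fun _ => sX K); split => [|i|u i].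
- by apply: isAut2_tangent_id; rewrite addrC addKr.
- exact: isAut1_id.
have vP : vanish2 1 (vX K + g) by apply: vanish2D (@vX_vanish K) (vanish2W _ vg).
have vQ : vanish2 1 (vY K + h) by apply: vanish2D (@vY_vanish K) (vanish2W _ vh).
rewrite comp_sX /psi_app (subst_subst2 vP vQ u (x0 i) (y0 i)).
have -> : subst (vX K + g) (x i) (y i) = x' i.
  by rewrite substD -/(ev (x0 i) (y0 i) (vX K)) -/(ev (x0 i) (y0 i) g) ev_vX eg addrC subrK.
have -> : subst (vY K + h) (x i) (y i) = y' i.
  by rewrite substD -/(ev (x0 i) (y0 i) (vY K)) -/(ev (x0 i) (y0 i) h) ev_vY eh addrC subrK.
by [].
Qed.

End Determinacy.

(** * Units and generators of the maximal ideal of K[[x,y]] *)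

Section LocalRing.
Variable K : fieldType.
Local Notation S2 := (series (series K)).
Implicit Types g h s : S2.

Lemma series2_inv g : g 0%N 0%N != 0 -> exists e, g * e = 1.
Proof.
move=> g0; have [e ge] := @series_inv K (g 0%N) _ (mulfV g0).
exact: series_inv ge.
Qed.

Lemma vanish2_sub_c2 g : vanish2 1 (g - c2 (g 0%N 0%N)).
Proof. by apply: vanish21; rewrite coef2B /c2 /sC /= subrr. Qed.

(** Write g = x g1 + y g2. If g1 is a unit, then x lies in (y, g) and s = y works; if g2 is a unit,
    s = x does. *)
Lemma maximal_ideal_gen g : g 0%N 0%N = 0 -> (g 1%N 0%N != 0) || (g 0%N 1%N != 0) ->
  exists2 s : S2, s 0%N 0%N = 0 &
    forall h, h 0%N 0%N = 0 -> exists h' b, h = s * h' + g * b.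
Proof.
move=> g0; have [g1 [g2 [-> <- <-]]] := vanish2_decomp g0.
case/orP => /series2_inv[e ge].
- exists (vY K) => // h /vanish2_decomp[h1 [h2 [-> _ _]]].
  exists (h2 - e * g2 * h1), (e * h1).
  transitivity (vX K * h1 * (g1 * e) + vY K * h2); first by rewrite ge mulr1.
  ring.
- exists (vX K) => // h /vanish2_decomp[h1 [h2 [-> _ _]]].
  exists (h1 - e * g1 * h2), (e * h2).
  transitivity (vX K * h1 + vY K * h2 * (g2 * e)); first by rewrite ge mulr1.
  ring.
Qed.

End LocalRing.

(** It suffices to avoid the roots of a product of nonzero polynomials a_i + b_i X, which is
    possible over an algebraically closed field. *)
Lemma exists_generic (K : closedFieldType) (r : nat) (a b : 'I_r -> K) :
  (forall i, (a i != 0) || (b i != 0)) -> exists l, forall i, a i + l * b i != 0.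
Proof.
move=> ab; pose p := \prod_(i < r) ((a i)%:P + b i *: 'X).
have p0 : p != 0.
  apply/prodf_neq0 => i _; apply: contraTneq (ab i) => e.
  have ek k : ((a i)%:P + b i *: 'X)`_k = 0 by rewrite e coef0.
  move: (ek 0%N) (ek 1%N); rewrite !coefD !coefC !coefZ !coefX /=.
  rewrite add0r mulr1 mulr0 addr0 => -> ->.
  by rewrite eqxx.
have [l] := closed_nonrootP p p0; rewrite /root horner_prod => /prodf_neq0 nz.
by exists l => i; have := nz i isT; rewrite hornerD hornerC hornerZ hornerX mulrC.
Qed.

(** * The ring of a parametrized curve *)

Section Curve.
Variables (K : closedFieldType) (f : series (series K)) (r : nat).
Local Notation S1 := (series K).
Local Notation S2 := (series (series K)).
Variables (x y : 'I_r -> S1) (c : 'I_r -> nat).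
Hypotheses (x0 : forall i, x i 0%N = 0) (y0 : forall i, y i 0%N = 0).
Local Notation psi i := (ev (x0 i) (y0 i)).
Hypothesis kerP : forall g : S2, (forall i, psi i g = 0) -> exists h, g = f * h.
Hypothesis psif : forall i, psi i f = 0.
Hypothesis condP : forall u : 'I_r -> S1, (forall i, vanish (c i) (u i)) ->
  exists g : S2, forall i, psi i g = u i.

(** If x_i = y_i = 0, then psi_i takes only constant values, whereas t^(c_i + 1) comes from C and so
    is a value of psi_i. The added 1 makes the exponent positive even if c_i = 0. *)
Lemma branch_order i : exists n, [/\ vanish n (x i), vanish n (y i)
  & (x i n != 0) || (y i n != 0)].
Proof.
have ex : exists n, (x i n != 0) || (y i n != 0).
  apply: contrapT => nex.
  have xy0 n : x i n = 0 /\ y i n = 0.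
    by split; apply/eqP; apply: contrapT => /negP ne; apply: nex; exists n; rewrite ne ?orbT.
  have xi0 : x i = 0 by apply: funext => n; have [] := xy0 n.
  have yi0 : y i = 0 by apply: funext => n; have [] := xy0 n.
  have [j n nj|g gP] := condP (u := fun j => sX K ^+ (c j).+1).
    by rewrite -[sX K ^+ _]mulr1 scoefXnM ltnS ltnW.
  have := congr1 (fun u : S1 => u (c i).+1) (gP i).
  rewrite -[sX K ^+ _]mulr1 scoefXnM ltnn subnn scoef1 /=.
  have [g1 [g2 [e _ _]]] := vanish2_decomp (@vanish2_sub_c2 _ g 0%N 0%N isT).
  rewrite -(subrK (c2 (g 0%N 0%N)) g) e !rmorphD !rmorphM /= ev_vX ev_vY ev_c2.
  move: (psi i g1) (psi i g2) => p1 p2; rewrite xi0 yi0 !mul0r !add0r => /esym/eqP.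
  by rewrite oner_eq0.
case: (ex_minnP ex) => n nP nmin; exists n; split=> // k kn.
- apply/eqP; apply: contraLR kn => xk; rewrite -leqNgt; apply: nmin; by rewrite xk.
- apply/eqP; apply: contraLR kn => yk; rewrite -leqNgt; apply: nmin; by rewrite yk orbT.
Qed.

Variable n : 'I_r -> nat.
Hypothesis nP : forall i, [/\ vanish (n i) (x i), vanish (n i) (y i)
  & (x i (n i) != 0) || (y i (n i) != 0)].

Lemma branch_order_gt0 i : (0 < n i)%N.
Proof. by rewrite lt0n; apply/eqP => n0; have [_ _] := nP i; rewrite n0 x0 y0 eqxx. Qed.

Variable lam : K.
Hypothesis lamP : forall i, x i (n i) + lam * y i (n i) != 0.

(** The generic linear form: psi_i(ell) has order exactly n_i on all branches at once. *)
Let ell : S2 := vX K + c2 lam * vY K.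

Let psi_ell i : psi i ell = x i + sC lam * y i.
Proof. by rewrite rmorphD rmorphM /= ev_vX ev_vY ev_c2. Qed.

Let vanish_ell i : vanish (n i) (psi i ell).
Proof.
have [vx vy _] := nP i; rewrite psi_ell; apply: vanishD => //.
exact: vanishMl.
Qed.

Let ell_order i : psi i ell (n i) != 0.
Proof. by rewrite psi_ell scoefD scoefCM lamP. Qed.

Let ell_neq0 i : psi i ell <> 0.
Proof. by move=> e; have := ell_order i; rewrite e scoef0 eqxx. Qed.

Let vanish2_ell : vanish2 1 ell.
Proof.
by apply: vanish2D (@vX_vanish K) _; apply: vanish2Ml (@vY_vanish K).
Qed.

(** Dividing by psi(ell)^k lowers the order by n_i k, so the quotient lies in C and therefore
    lifts. *)
Let psi_div_ell k (u : 'I_r -> S1) : (forall i, vanish (n i * k + c i) (u i)) ->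
  exists g, forall i, psi i (ell ^+ k * g) = u i.
Proof.
move=> vu.
have [w wP] : exists w : 'I_r -> S1,
    forall i, vanish (c i) (w i) /\ u i = psi i ell ^+ k * w i.
  apply: (@fin_all_exists _ (fun=> S1) (fun i w =>
    vanish (c i) w /\ u i = psi i ell ^+ k * w)) => i.
  have [|||w vw uw] := @series_div K (n i * k) (c i) (psi i ell ^+ k) (u i) => //.
  - exact: (vanishX (i:=k) (@vanish_ell i)).
  - by rewrite scoefX_low // expf_neq0.
  by exists w.
have [|g gP] := condP (u := w); first by move=> i; have [] := wP i.
by exists g => i; rewrite rmorphM rmorphXn /= gP; have [_ ->] := wP i.
Qed.

(* Substituting (x, y) := (- lam s, s) kills [ell] and sends f into (s^m), so the
   coefficients [a 0 j] vanish; then one factor [ell] is cancelled. *)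
Let ell_independent m N (a : nat -> nat -> K) h : vanish2 m f ->
  (forall i, psi i (\sum_(k < N) ell ^+ k * (\sum_(j < m) c2 (a k j) * vY K ^+ j)
                    + ell ^+ N * h) = 0) ->
  forall k j, (k < N)%N -> (j < m)%N -> a k j = 0.
Proof.
move=> vf; elim: N a h => // N IHN a h ker.
pose q k := \sum_(j < m) c2 (a k j) * vY K ^+ j.
pose p := \sum_(k < N) ell ^+ k * q k.+1 + ell ^+ N * h.
have E : \sum_(k < N.+1) ell ^+ k * q k + ell ^+ N.+1 * h = q 0%N + ell * p.
  rewrite big_ord_recl expr0 mul1r /p mulrDr mulr_sumr -addrA; congr (_ + (_ + _)).
    by apply: eq_bigr => k _; rewrite mulrA -exprS.
  by rewrite exprS mulrA.
have {}ker i : psi i (q 0%N + ell * p) = 0 by rewrite -E ker.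
have s0 : sX K 0%N = 0 by [].
have t0 : (- (sC lam * sX K)) 0%N = 0 by rewrite scoefN scoefCM mulr0 oppr0.
have a0 j : (j < m)%N -> a 0%N j = 0.
  move=> jm; have [u fu] := kerP ker.
  have := congr1 (fun g => ev t0 s0 g j) fu; rewrite rmorphM.
  rewrite [RHS](@vanishMr _ m) //; last first.
    rewrite -[m]mul1n; apply: ev_vanish => //; exact: vanish1.
  rewrite rmorphD rmorphM rmorphD rmorphM /= ev_vX ev_vY ev_c2 addNr mul0r addr0.
  rewrite rmorph_sum scoef_sum (bigD1 (Ordinal jm)) //= big1 => [|l lj].
    by rewrite addr0 rmorphM rmorphXn /= ev_c2 ev_vY scoefCM -[_ ^+ j]mulr1 scoefXnM
      ltnn subnn scoef1 mulr1.
  rewrite rmorphM rmorphXn /= ev_c2 ev_vY scoefCM -[_ ^+ l]mulr1 scoefXnM scoef1 subn_eq0.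
  case: ltnP => [|lej]; rewrite ?mulr0 //.
  move: lj; rewrite -val_eqE /= => lj; rewrite leqNgt ltn_neqAle lj lej /=; exact: mulr0.
have q0 : q 0%N = 0.
  by rewrite /q big1 // => j _; rewrite a0 ?ltn_ord // /c2 !rmorph0 mul0r.
have kerp i : psi i p = 0.
  apply: (series_mulI (@ell_neq0 i)); rewrite mulr0 -rmorphM /=.
  by have := ker i; rewrite q0 add0r.
move=> [|k] j kN jm; first exact: a0.
exact: (IHN (fun k => a k.+1) h kerp).
Qed.

(** Otherwise some nontrivial combination p of the ell^k y^j has psi(p) of such high order that
    psi(p) = psi(ell^(N+1) h), and [ell_independent] then kills all its coefficients. *)
Lemma mult_le_sum_orders m : vanish2 m f -> (m <= \sum_i n i)%N.
Proof.
move=> vf; rewrite leqNgt; apply/negP => nm.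
case: m vf nm => // m vf nm; pose N := (\sum_i c i)%N.
(* With N = sum c_i and, after the case split, sum n_i <= m, there are at most m (N + 1) + N
   equations for (m + 1)(N + 1) unknowns. *)
pose A := ('I_N.+1 * 'I_m.+1)%type.
pose B := {i : 'I_r & 'I_(n i * N.+1 + c i)}.
have cardB : (#|{: B}| < #|{: A}|)%N.
  rewrite card_prod !card_ord card_tagged sumnE big_map big_enum /=.
  rewrite (eq_bigr (fun i => n i * N.+1 + c i)%N) => [|i _]; last by rewrite card_ord.
  rewrite big_split /= -big_distrl /= -/N [(_ * m.+1)%N]mulnS.
  rewrite (_ : \sum_(i in 'I_r) n i = \sum_i n i)%N; last exact: eq_bigl.
  have : ((\sum_i n i) * N.+1 <= m * N.+1)%N by rewrite leq_mul2r -ltnS nm orbT.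
  by rewrite (mulnC m) => le; rewrite addnC -addSn leq_add2l.
pose mon (a : A) : S2 := ell ^+ a.1 * vY K ^+ a.2.
have [l [a la] lP] := kernel_of_card
  (fun (b : B) a => psi (tag b) (mon a) (tagged b)) cardB.
pose p : S2 := \sum_a c2 (l a) * mon a.
have pE : p = \sum_k \sum_j c2 (l (k, j)) * mon (k, j).
  by rewrite pair_bigA; apply: eq_bigr => -[].
have [|h hP] := psi_div_ell (k := N.+1) (u := fun i => psi i p).
  move=> i e ei; have := lP (Tagged (fun i => 'I_(n i * N.+1 + c i)) (Ordinal ei)) => /=.
  rewrite rmorph_sum scoef_sum => {2}<-; apply: eq_bigr => b _.
  by rewrite rmorphM /= ev_c2 scoefCM.
move/eqP: la; case: a => k j; apply.
have := @ell_independent m.+1 N.+1 (fun k j => l (inord k, inord j)) (- h) vf.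
move=> /(_ _ k j (ltn_ord k) (ltn_ord j)); rewrite !inord_val; apply => i.
rewrite mulrN rmorphB /= hP -rmorphB pE.
rewrite -sumrB big1 ?rmorph0 // => k' _; rewrite mulr_sumr -sumrB big1 // => j' _.
by rewrite !inord_val /mon /=; ring.
Qed.

(** A lift of t has no constant term, so its order on branch i is at least n_i, which excludes n_i >
    1. An element equal to 1 on one branch and 0 on another has no lift, since all psi_i(g) share
    the constant term of g. *)
Lemma unramified_of_full : (forall u : 'I_r -> S1, exists g, forall i, psi i g = u i) ->
  (\sum_i n i <= 1)%N.
Proof.
move=> full.
have n1 i : n i = 1%N.
  apply/eqP; rewrite eqn_leq branch_order_gt0 andbT leqNgt; apply/negP => n2.
  have [g gP] := full (fun _ => sX K).
  have g0 : g 0%N 0%N = 0 by rewrite -(ev_coef0 (x0 i) (y0 i)) gP.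
  have [g1 [g2 [e _ _]]] := vanish2_decomp g0.
  have [vx vy _] := nP i.
  have := congr1 (fun u : S1 => u 1%N) (gP i); rewrite e rmorphD !rmorphM /= ev_vX ev_vY.
  rewrite scoefD (vanishMr _ vx) // (vanishMr _ vy) // addr0 => /esym/eqP.
  by rewrite oner_eq0.
rewrite (eq_bigr (fun=> 1%N)) // sum1_card card_ord leqNgt; apply/negP => r2.
pose i := Ordinal (ltnW r2); pose j := Ordinal r2.
have [g gP] := full (fun k => if k == i then 1 else 0).
have := congr1 (fun u : S1 => u 0%N) (gP i); have := congr1 (fun u : S1 => u 0%N) (gP j).
by rewrite !ev_coef0 /= => -> /esym/eqP; rewrite oner_eq0.
Qed.

(** Now m = (s, f), so every element of psi(m) is psi(s) times an element of R. For N = sum c_j the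
    product psi(s)^N u lies in C and lifts; the factors psi(s) are then cancelled one by one. *)
Lemma full_of_smooth : f 0%N 0%N = 0 -> (f 1%N 0%N != 0) || (f 0%N 1%N != 0) ->
  forall u : 'I_r -> S1, exists g, forall i, psi i g = u i.
Proof.
move=> f0 /(maximal_ideal_gen f0)[s s0 sP] u.
have psi_m g i : g 0%N 0%N = 0 -> exists h, psi i g = psi i s * psi i h.
  by move=> /sP[h [b ->]]; exists h; rewrite rmorphD !rmorphM /= psif mul0r addr0.
have psis i : psi i s <> 0.
  move=> e; have [_ _] := nP i.
  have [|h] := psi_m (vX K) i; first by apply: (@vX_vanish K).
  have [|h'] := psi_m (vY K) i; first by apply: (@vY_vanish K).
  by rewrite ev_vX ev_vY e !mul0r => -> ->; rewrite eqxx.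
have vs i : vanish 1 (psi i s) by apply: vanish1; rewrite ev_coef0.
have [|g gP] := condP (u := fun i => psi i s ^+ (\sum_j c j) * u i).
  move=> i; apply: vanishMr; apply: vanishW (vanishX (i:=_) (vs i)).
  by rewrite mul1n (bigD1 i) //= leq_addr.
elim: (\sum_j c j)%N g gP => [|N IHN] g gP; first by exists g => i; rewrite gP mul1r.
have [r0|i0] := pselect ('I_r -> False); first by exists 0 => i; case: (r0 i).
have [i _] : exists i : 'I_r, True
  by apply: contrapT => nex; apply: i0 => i; apply: nex; exists i.
have g0 : g 0%N 0%N = 0.
  by rewrite -(ev_coef0 (x0 i) (y0 i)) gP exprS -mulrA scoef0M ev_coef0 s0 mul0r.
have [h [b e]] := sP g g0; apply: (IHN h) => j.
apply: (series_mulI (@psis j)); rewrite mulrA -exprS -gP e.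
by rewrite rmorphD !rmorphM /= psif mul0r addr0.
Qed.

(** If c = 0 then R = Rbar and sum n_i <= 1, against the multiplicity bound. *)
Lemma conductor_gt0 : vanish2 2 f -> exists i, (0 < c i)%N.
Proof.
move=> /mult_le_sum_orders n2; apply: contrapT => nex.
have c0 i : c i = 0%N.
  by apply/eqP; rewrite -leqn0 leqNgt; apply/negP => ci; apply: nex; exists i.
suff : (\sum_i n i <= 1)%N by rewrite leqNgt n2.
by apply: unramified_of_full => u; apply: condP => i; rewrite c0.
Qed.

(* Otherwise m = (s, g) for some s.  Choose k minimal with psi(s)^k = psi(g) w,
   w in Rbar.  Then psi(g) Rbar lies in R and is contained in psi(s^k) R + psi(g) R, so
   Rbar = R w + R and Rbar / m Rbar, of dimension [\sum_i n i], is spanned by 1 and w. *)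
Lemma conductor_sub_m2 g i0 : (2 < \sum_i n i)%N -> (0 < c i0)%N ->
  (forall i, vanish (c i) (psi i g)) -> vanish2 2 g.
Proof.
move=> n3 ci0 vg.
have g0 : g 0%N 0%N = 0 by rewrite -(ev_coef0 (x0 i0) (y0 i0)) vg.
apply: contrapT => nv.
have glin : (g 1%N 0%N != 0) || (g 0%N 1%N != 0).
  apply/negPn/negP; rewrite negb_or !negbK => /andP[/eqP g10 /eqP g01]; apply: nv.
  by case=> [|[|a]] [|[|b]].
clear nv.
(* On branches where psi_i(g) = 0, a nonzero value is added through a multiple of ell^2. It lies in
   m^2 and maps into C, so the linear part of g and the hypotheses are preserved. *)
wlog psig : g vg g0 glin / forall i, psi i g <> 0.
  move=> hyp.
  have [|h hP] := psi_div_ell (k := 2)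
      (u := fun i => if psi i g == 0 then sX K ^+ (n i * 2 + c i) else 0).
    move=> i; case: ifP => // _ k kn.
    by rewrite -[_ ^+ _]mulr1 scoefXnM kn.
  have vh : vanish2 2 (ell ^+ 2 * h).
    by rewrite mulrC; apply: vanish2Ml; apply: (vanish2X (i:=2) vanish2_ell).
  apply: (hyp (g + ell ^+ 2 * h)) => [i||| i].
  - rewrite rmorphD /= hP; apply: vanishD => //; case: ifP => // _ k kn.
    by rewrite -[_ ^+ _]mulr1 scoefXnM (leq_trans kn) // leq_addl.
  - by rewrite coef2D g0 vh ?addr0.
  - by rewrite !coef2D !vh ?addr0.
  - rewrite rmorphD /= hP; case: eqP => [->|]; rewrite ?addr0 // add0r => e.
    have := congr1 (fun u : S1 => u (n i * 2 + c i)%N) e.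
    rewrite -[_ ^+ _]mulr1 scoefXnM ltnn subnn => /eqP; by rewrite oner_eq0.
have [s s0 sP] := maximal_ideal_gen g0 glin.
have vs i : vanish 1 (psi i s) by apply: vanish1; rewrite ev_coef0.
(* As psi_i(s) has order at least 1, the sum of the orders of the psi_i(g) is such a k. *)
have ex : exists k, `[< exists w : 'I_r -> S1, forall i, psi i s ^+ k = psi i g * w i >].
  have [a aP] : exists a : 'I_r -> nat,
      forall i, vanish (a i) (psi i g) /\ psi i g (a i) != 0.
    apply: (@fin_all_exists _ (fun=> nat) (fun i a =>
      vanish a (psi i g) /\ psi i g a != 0)) => i.
    by have [a] := exists_order (@psig i); exists a.
  exists (\sum_i a i)%N; apply/asboolP.
  apply: (@fin_all_exists _ (fun=> S1) (fun i w =>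
    psi i s ^+ (\sum_i a i) = psi i g * w)) => i.
  have [va ga] := aP i.
  have [|w _ wP] := series_div (e := 0) va ga (v := psi i s ^+ (\sum_i a i)).
    apply: vanishW (vanishX (i:=_) (vs i)); by rewrite mul1n addn0 (bigD1 i) //= leq_addr.
  by exists w.
case: (ex_minnP ex) => k /asboolP[w wP] kmin.
(* Factors s are extracted one at a time. A unit cofactor h' at a stage j < k would put psi(s)^j
   into psi(g) Rbar, against the minimality of k. *)
have divs h (v : 'I_r -> S1) j : (j <= k)%N -> (forall i, psi i h = psi i g * v i) ->
    exists h' b, h = s ^+ j * h' + g * b.
  move=> jk hv; elim: j jk => [|j IHj] jk.
    by exists h, 0; rewrite mul1r mulr0 addr0.
  have [h' [b e]] := IHj (ltnW jk).
  have [h'0|/series2_inv[u hu]] := eqVneq (h' 0%N 0%N) 0.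
    have [h'' [b' e']] := sP h' h'0; exists h'', (s ^+ j * b' + b).
    by rewrite e e' exprSr; ring.
  move: jk; rewrite ltnNge => /negP; case; apply: kmin; apply/asboolP.
  exists (fun i => (v i - psi i b) * psi i u) => i.
  rewrite mulrA mulrBr -hv -rmorphM -rmorphB -rmorphM -rmorphXn /=; congr (psi i _).
  transitivity (s ^+ j * (h' * u)); first by rewrite hu mulr1.
  by rewrite e; ring.
have psi_const i h : vanish (n i) (psi i h - sC (h 0%N 0%N)).
  have [vx vy _] := nP i; rewrite -(ev_c2 (x0 i) (y0 i)) -rmorphB -[n i]muln1.
  exact: ev_vanish (@vanish2_sub_c2 _ h).
(* Cancelling psi(g) gives v = psi(h') w + psi(b); modulo t^(n_i) both psi(h') and psi(b) reduce to
   constants. *)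
have gen (v : 'I_r -> S1) : exists a b, forall i j, (j < n i)%N ->
    v i j = a * w i j + b * (j == 0%N)%:R.
  have [|h hP] := condP (u := fun i => psi i g * v i).
    by move=> i; apply: vanishMr.
  have [h' [b e]] := divs h v k (leqnn k) hP.
  exists (h' 0%N 0%N), (b 0%N 0%N) => i j jn.
  have -> : v i = psi i h' * w i + psi i b.
    apply: (series_mulI (@psig i)); rewrite -hP e rmorphD !rmorphM rmorphXn /= wP; ring.
  have vhw : vanish (n i) ((psi i h' - sC (h' 0%N 0%N)) * w i + (psi i b - sC (b 0%N 0%N))).
    by apply: vanishD => //; apply: vanishMr.
  have -> : psi i h' * w i + psi i b =
    ((psi i h' - sC (h' 0%N 0%N)) * w i + (psi i b - sC (b 0%N 0%N))) +
    (sC (h' 0%N 0%N) * w i + sC (b 0%N 0%N) * 1) by ring.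
  by rewrite scoefD vhw // add0r scoefD !scoefCM scoef1.
pose A := {i : 'I_r & 'I_(n i)}.
have cardA : (#|{: bool}| < #|{: A}|)%N.
  rewrite card_bool card_tagged sumnE big_map big_enum /=.
  by rewrite (eq_bigr n) // => i _; rewrite card_ord.
(* A nonzero linear form l on Rbar / m Rbar that kills w ([true]) and 1 ([false]). By [gen] it also
   kills the basis vector at a, where its value is l a. *)
have [l [a la] lP] := kernel_of_card
  (fun (b : bool) (a : A) =>
     if b then w (tag a) (tagged a) else (tagged a == 0%N :> nat)%:R) cardA.
have [al [be vP]] := gen (fun i e => ((i == tag a) && (e == tagged a :> nat))%:R).
move/eqP: la; apply.
have : \sum_(b : A) l b * ((tag b == tag a) && (tagged b == tagged a :> nat))%:R = l a.
  rewrite (bigD1 a) //= !eqxx mulr1 big1 ?addr0 // => b ba.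
  case: andP => [[/eqP ei /eqP ee]|_]; last by rewrite mulr0.
  case/eqP: ba; case: b a ei ee {lP vP} => [i e] [i' e'] /= ei.
  by subst i' => /val_inj ->.
move=> <-; rewrite (eq_bigr (fun b : A =>
  al * (l b * w (tag b) (tagged b)) + be * (l b * (tagged b == 0%N :> nat)%:R))).
  by rewrite big_split /= -!mulr_sumr (lP true) (lP false) !mulr0 addr0.
by move=> b _; rewrite (vP (tag b) (tagged b)) ?ltn_ord //; ring.
Qed.

(** The quotient of u by psi(ell) has positive order on branch i0, so its lift h has no constant
    term and ell h lies in m^2. *)
Lemma lift_m2 i0 (u : 'I_r -> S1) : (0 < c i0)%N ->
  (forall i, vanish (n i + c i) (u i)) -> exists2 g, vanish2 2 g & forall i, psi i g = u i.
Proof.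
move=> ci0 vu; have [|h hP] := psi_div_ell (k := 1) (u := u).
  by move=> i; rewrite muln1.
have h0 : h 0%N 0%N = 0.
  rewrite -(ev_coef0 (x0 i0) (y0 i0)).
  have [|||w vw] := @series_div K (n i0) (c i0) (psi i0 ell) (u i0) => //.
  by rewrite -hP rmorphM /= expr1 => /(series_mulI (@ell_neq0 i0)) ->; rewrite vw.
exists (ell * h); last by move=> i; have := hP i; rewrite expr1.
exact: (vanish2M vanish2_ell (vanish21 h0)).
Qed.

Lemma lift_m2_smooth (u : 'I_r -> S1) :
  f 0%N 0%N = 0 -> (f 1%N 0%N != 0) || (f 0%N 1%N != 0) ->
  (forall i, vanish 2 (u i)) -> exists2 g, vanish2 2 g & forall i, psi i g = u i.
Proof.
move=> f0 flin vu; have full := full_of_smooth f0 flin.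
have n1 i : n i = 1%N.
  have := unramified_of_full full; rewrite (bigD1 i) //=.
  have := branch_order_gt0 i; lia.
have [w wP] : exists w : 'I_r -> S1, forall i, u i = psi i ell ^+ 2 * w i.
  apply: (@fin_all_exists _ (fun=> S1) (fun i w => u i = psi i ell ^+ 2 * w)) => i.
  have [|||w vw uw] := @series_div K 2 0 (psi i ell ^+ 2) (u i) => //.
  - by have := vanishX (i:=2) (@vanish_ell i); rewrite n1.
  - by have := scoefX_low 2 (@vanish_ell i); rewrite n1 => ->; rewrite expf_neq0 // -(n1 i).
  by exists w.
have [h hP] := full w; exists (ell ^+ 2 * h) => [|i].
  by rewrite mulrC; apply: vanish2Ml; apply: (vanish2X (i:=2) vanish2_ell).
by rewrite rmorphM rmorphXn /= hP wP.
Qed.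

End Curve.

(** * The determinacy bound, by cases on the multiplicity and on sum n_i *)

Theorem theorem2p1 (K : closedFieldType) (f : ps2 K) (r : nat)
    (x y : 'I_r -> ps K) (c : 'I_r -> nat) (m : nat) :
  f 0%N 0%N = 0 ->
  ps2_reduced f ->
  is_parametrization f x y ->
  is_conductor x y c ->
  mt_is f m ->
  param_determined x y (dbound m c) /\
  param_determined x y (fun i => (c i).+1).
Proof.
move=> f0 _ [J ker _ _] cond [vf [a [b [abm fab]]]].
have x0 i : x i 0%N = 0 by have [] := J i.
have y0 i : y i 0%N = 0 by have [] := J i.
have kerP (g : series (series K)) : (forall i, ev (x0 i) (y0 i) g = 0) ->
    exists h : series (series K), g = (f : series (series K)) * h.
  by move=> /(ker g).1[h ->]; exists h; exact: ps2mulE.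
have psif i : ev (x0 i) (y0 i) f = 0.
  apply: ((ker f).2 _ i); exists (1 : series (series K)).
  by rewrite ps2mulE mulr1.
have condP (u : 'I_r -> series K) : (forall i, vanish (c i) (u i)) ->
    exists g : series (series K), forall i, ev (x0 i) (y0 i) g = u i.
  (* Testing the conductor condition on v = 1 shows that u itself lies in R. *)
  move=> /(cond u).2/(_ (fun _ => 1 : series K))[g gP]; exists g => i.
  by rewrite -[RHS]mulr1; apply/esym; exact: gP.
have [n nP] : exists n : 'I_r -> nat, forall i, [/\ vanish (n i) (x i : series K),
    vanish (n i) (y i : series K) & (x i (n i) != 0) || (y i (n i) != 0)].
  apply: (@fin_all_exists _ (fun=> nat) (fun i n => [/\ vanish n (x i : series K),
    vanish n (y i : series K) & (x i n != 0) || (y i n != 0)])) => i.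
  exact: branch_order condP i.
have [lam lamP] : exists l, forall i, x i (n i) + l * y i (n i) != 0.
  by apply: exists_generic => i; have [] := nP i.
have det : param_determined x y (dbound m c).
  apply: (param_determined_lift (x0 := x0) (y0 := y0)) => u vu.
  case: m vf abm vu => [|[|m]] vf abm vu.
  - by case: a b abm fab => [|a] [|b] // _; rewrite f0 eqxx.
  - apply: (lift_m2_smooth psif condP nP lamP f0) => // {vu}.
    case: a b abm fab => [|[|a]] [|[|b]] //= _ ->; by rewrite ?orbT.
  have [i0 ci0] := conductor_gt0 kerP condP nP lamP (vanish2W (isT : (1 < m.+2)%N) vf).
  (* In the first case u lies in C, because c_i <= d_i + 1 for each value of d when mt(f) >= 2,
     truncated subtraction included. *)
  have [n3|n2] := ltnP 2 (\sum_i n i).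
    have [|g gP] := condP u.
      by move=> i; apply: vanishW (vu i); rewrite /dbound /=; do 2?case: ifP => _; lia.
    exists g => //; apply: (conductor_sub_m2 condP nP lamP n3 ci0) => i; rewrite gP.
    by apply: vanishW (vu i); rewrite /dbound /=; do 2?case: ifP => _; lia.
  (* Here mt(f) = sum n_j = 2, and each other branch contributes at least 1, so n_i + r - 1 <= 2.
     Thus n_i <= 2 if r = 1 and n_i <= 1 if r = 2, which yields n_i + c_i <= d_i + 1. *)
  apply: (lift_m2 condP nP lamP ci0) => i; apply: vanishW (vu i).
  have mn := mult_le_sum_orders kerP condP nP lamP vf.
  have m0 : m = 0%N by lia.
  have rn : (n i + r.-1 <= \sum_j n j)%N.
    rewrite (bigD1 i) //= leq_add2l.
    have <- : (\sum_(j < r | j != i) 1 = r.-1)%N by rewrite sum1_card cardC1 card_ord.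
    apply: leq_sum => j _; exact: (branch_order_gt0 x0 y0 nP).
  have r0 : (0 < r)%N by exact: leq_ltn_trans (ltn_ord i).
  rewrite /dbound m0 /=; case: eqP => [r1|r1]; first by lia.
  by case: eqP => [r2|r2]; lia.
split=> //; apply: param_determined_mono det => i.
by rewrite /dbound; do 3?case: ifP => _; rewrite ?addn1 ?leqnSn //; lia.
Qed.
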